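(* Let $P_n(x)$, $n\ge 1$, be the sextet polynomials of the pyrene chains $P_n$. Each $x\in\left[-(\sqrt{2}+1)^2,-(\sqrt{2}-1)^2\right]$ is a limit of zeros of the sequence $(P_n(x))_n$. As a result, the set of zeros of all the polynomials $P_n(x)$ is dense in the closed interval $$\left[-(\sqrt{2}+1)^2,\,-(\sqrt{2}-1)^2\right].$$
   Context: A complex number $x$ is a limit of zeros of a sequence of polynomials $(f_n)_{n}$ if there is a sequence $(z_n)_{n}$ of complex numbers such that $f_n(z_n)=0$ for all $n$ and $z_n\to x$ as $n\to+\infty$ (here with $n\ge 1$). A hexagonal system is a finite connected plane graph without cut vertices in which every interior face is bounded by a regular hexagon of side length $1$; its hexagons are its interior faces. Let $H$ be a hexagonal system with at least one perfect matching (Kekulé structure). A Clar cover of $H$ is a spanning subgraph of $H$ each connected component of which is either a hexagon or an edge. A resonant pattern of $H$ is the set of hexagons of a Clar cover of $H$. The Clar number $C(H)$ is the maximum number of hexagons in a resonant pattern. The sextet polynomial of $H$ is $\sigma(H,x)=\sum_{k=0}^{C(H)}s(H,k)x^k$, where $s(H,k)$ is the number of resonant patterns of $H$ with exactly $k$ hexagons and $s(H,0)=1$. The pyrene chain $P_n$ ($n\ge 1$) is the hexagonal system with $4n$ hexagons consisting of a straight horizontal row of $2n$ hexagons $h_1,\dots,h_{2n}$ of the hexagonal lattice (consecutive ones sharing a vertical edge) together with, for each $i=1,\dots,n$, the lattice hexagon above the row adjacent to both $h_{2i-1}$ and $h_{2i}$ and the lattice hexagon below the row adjacent to both $h_{2i-1}$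 and $h_{2i}$. Its sextet polynomial is denoted $P_n(x)=\sigma(P_n,x)$, and $P_0(x)=1$ by convention. These polynomials are determined by $P_0(x)=1$, $P_1(x)=x^2+4x+1$ and the known recurrence $P_n(x)=(x^2+4x+1)P_{n-1}(x)-x^2P_{n-2}(x)$ for $n\ge 2$. *)

(* Defs.v *)
(* MathComp + MathComp-Analysis, with finmap and real-closed. *)
From mathcomp Require Import all_boot all_order all_algebra finmap complex.
From mathcomp Require Import all_classical all_reals all_analysis.

Set Implicit Arguments.
Unset Strict Implicit.
Unset Printing Implicit Defensive.

Import Order.TTheory GRing.Theory Num.Theory.
Import numFieldNormedType.Exports.

Local Open Scope fset_scope.
Local Open Scope ring_scope.
Local Open Scope complex_scope.

(* Points of the plane are written (X, Y), standing for the Cartesian point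
   (X * sqrt 3 / 2, Y / 2); all vertices of the hexagonal lattice whose regular
   hexagons have side length 1 and two vertical sides, one of them centred at
   the origin, have integer coordinates X, Y.  A lattice hexagon is given by
   axial coordinates (a, b): b is its row, (a + 1, b) is its right neighbour,
   and (a, b + 1), (a - 1, b + 1) are its two neighbours in the row above. *)
Definition lattice_point := (int * int)%type.
Definition hexagon := (int * int)%type.

Definition corners (h : hexagon) : seq lattice_point :=
  let X := 2 * h.1 + h.2 in
  let Y := 3 * h.2 in
  [:: (X, Y + 2); (X + 1, Y + 1); (X + 1, Y - 1);
      (X, Y - 2); (X - 1, Y - 1); (X - 1, Y + 1)].

Definition hex_vertices (h : hexagon) : {fset lattice_point} :=
  [fset p in corners h].

Definition hex_edges (h : hexagon) : {fset {fset lattice_point}} :=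
  [fset [fset p; next (corners h) p] | p in corners h].

(* A hexagonal system is represented by the set S of its hexagons, i.e. of all
   its interior faces; its plane graph is the union of their boundaries. *)
Definition vertices (S : {fset hexagon}) : {fset lattice_point} :=
  \bigcup_(h <- S) hex_vertices h.

Definition edges (S : {fset hexagon}) : {fset {fset lattice_point}} :=
  \bigcup_(h <- S) hex_edges h.

Section ClarCovers.
Variable S : {fset hexagon}.

(* A spanning subgraph is given by its set F of edges, a subset of edges S. *)
Definition adj (F : {fset {fset lattice_point}}) : rel (vertices S) :=
  fun u v => [fset val u; val v] \in F.

Definition comp_vertices (F : {fset {fset lattice_point}}) (v : vertices S) :
    {fset lattice_point} :=
  [fset val w | w in connect (adj F) v].

Definition comp_edges (F : {fset {fset lattice_point}}) (v : vertices S) :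
    {fset {fset lattice_point}} :=
  [fset e in F | e `<=` comp_vertices F v].

Definition comp_is_hexagon F (v : vertices S) (h : hexagon) : bool :=
  (comp_vertices F v == hex_vertices h) && (comp_edges F v == hex_edges h).

Definition comp_is_edge F (v : vertices S) (e : {fset lattice_point}) : bool :=
  (comp_vertices F v == e) && (comp_edges F v == [fset e]).

Definition clar_cover (F : {fset {fset lattice_point}}) : bool :=
  (F `<=` edges S) &&
  [forall v : vertices S,
     [exists h : S, comp_is_hexagon F v (val h)]
     || [exists e : edges S, comp_is_edge F v (val e)]].

Definition cover_hexagons (F : {fset {fset lattice_point}}) : {fset hexagon} :=
  [fset h in S | [exists v : vertices S, comp_is_hexagon F v h]].

Definition resonant_patterns : {fset {fset hexagon}} :=
  [fset cover_hexagons F | F in fpowerset (edges S) & clar_cover F].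

Definition clar_number : nat := \max_(P <- resonant_patterns) #|` P|.

Definition num_patterns (k : nat) : nat :=
  #|` [fset P in resonant_patterns | #|` P| == k]|.

(* When S has a perfect matching, the empty set is a resonant pattern, so that
   num_patterns 0 = 1. *)
Definition sextet_poly : {poly int} :=
  \sum_(k < clar_number.+1) (num_patterns k)%:R *: 'X^k.

End ClarCovers.

(* The hexagon (j, 0) is h_j; (2 i - 1, 1) and (2 i, -1) are the hexagons above
   and below the row that are adjacent to both h_(2i-1) and h_(2i). *)
Definition pyrene_chain (n : nat) : {fset hexagon} :=
  [fset h in [seq (j%:Z, 0) | j <- index_iota 1 n.*2.+1]
          ++ [seq (2 * i%:Z - 1, 1) | i <- index_iota 1 n.+1]
          ++ [seq (2 * i%:Z, -1) | i <- index_iota 1 n.+1]].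

Definition pyrene_poly (R : realType) (n : nat) : {poly R[i]} :=
  map_poly intr (sextet_poly (pyrene_chain n)).

(* The topology of R[i] given by its modulus is carried by R[i]^o.  Sequences
   of polynomials are indexed by n >= 1. *)
Definition limit_of_zeros (R : realType) (f : nat -> {poly R[i]})
    (x : R[i]^o) : Prop :=
  exists z : nat -> R[i]^o,
    (forall n, (1 <= n)%N -> root (f n) (z n)) /\
    (z n @[n --> \oo] --> x)%classic.

Definition zero_set (R : realType) (f : nat -> {poly R[i]}) : set R[i]^o :=
  [set z | exists2 n, (1 <= n)%N & root (f n) z]%classic.

(* The real interval [a, b] as a set of complex numbers. *)
Definition real_segment (R : realType) (a b : R) : set R[i]^o :=
  [set r%:C | r in `[a, b]]%classic.

(* Density of (the points of A lying in B) in B, for the topology of B. *)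
Definition dense_in (T : topologicalType) (A B : set T) : Prop :=
  (B `<=` closure (A `&` B))%classic.

(* Main.v *)
Require Import Defs.
From mathcomp Require Import all_boot all_order all_algebra finmap complex.
From mathcomp Require Import all_classical all_reals all_analysis.
From mathcomp Require Import zify ring lra.

(** The pyrene chain is a row of cells, each cell being a pyrene.

    Combinatorics.  The hexagons of a Clar cover are pairwise disjoint, being
    distinct components of one graph.  Conversely, any set P of pairwise
    disjoint hexagons of a pyrene chain is a resonant pattern: what is left
    uncovered by P is perfectly matched as follows.  The vertices of the chain
    are partitioned by the upper hexagons, the lower hexagons, and the vertical
    edges through which successive cells are glued (together with the two end
    edges of the chain).  Keep each vertical edge, and in every upper and lower
    hexagon keep one of the two ways of matching its six corners alternately.
    The choice, which is made cell by cell, depends only on whether P contains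
    the left hexagon of the row in that cell; with it, each hexagon of P is a
    union of matched pairs (partner_covered), so the uncovered vertices are
    matched among themselves (matching_resonant, pyrene_resonant).

    Hence the sextet polynomial is the independence polynomial of the graph of
    hexagons, with adjacency given by touching (sextet_pyreneE).  Deleting the
    hexagons of the last cell one at a time expresses it through the chain with
    one cell less and through that same chain without the last hexagon of its
    row; eliminating the latter gives the three-term recurrence
    sextet_pyreneSS.

    Zeros.  If y ^ 2 + 1 = (4 + 2 cos t) y, the recurrence at - y becomes that
    of the Chebyshev polynomials of the second kind, up to powers of y, so
    P_n(- y) sin t = y ^ n sin ((n + 1) t) (pyrene_poly_trig).  The equation in
    y has the two solutions c + s sqrt (c ^ 2 - 1), where c = 2 + cos t and
    s = 1 or -1; when t runs over [0, pi], the opposites of these values cover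
    the segment of the theorem (branch_itv, branch_surj).  Taking for t_n a
    multiple of pi / (n + 1) lying strictly between 0 and pi and at a distance
    O(1 / n) from t gives a zero of P_n in the segment, and these zeros
    converge to the point of parameter t since the two branches are continuous
    (real_zeros).  As the zeros found are in the segment, density follows. *)

Set Implicit Arguments.
Unset Strict Implicit.
Unset Printing Implicit Defensive.

Import Order.TTheory GRing.Theory Num.Theory.
Import numFieldNormedType.Exports.

Local Open Scope ring_scope.

Section Combinatorics.

Local Open Scope fset_scope.
Local Open Scope ring_scope.

(** * Hexagons and Clar covers *)

Lemma in_hex_vertices h p : (p \in hex_vertices h) = (p \in corners h).
Proof. by rewrite in_fset. Qed.

Lemma verticesP (S : {fset hexagon}) p :
  reflect (exists2 h, h \in S & p \in hex_vertices h) (p \in vertices S).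
Proof.
apply: (iffP (bigfcupP _ _ _ _)) => -[h hS ph]; exists h => //.
  by rewrite andbT in hS.
by rewrite hS.
Qed.

Lemma edgesP (S : {fset hexagon}) e :
  reflect (exists2 h, h \in S & e \in hex_edges h) (e \in edges S).
Proof.
apply: (iffP (bigfcupP _ _ _ _)) => -[h hS ph]; exists h => //.
  by rewrite andbT in hS.
by rewrite hS.
Qed.

Lemma hex_edgesP h e :
  reflect (exists2 p, p \in corners h & e = [fset p; next (corners h) p])
          (e \in hex_edges h).
Proof. by apply: (iffP (imfsetP _ _ _ _)) => -[p ph ->]; exists p. Qed.

Lemma uniq_corners h : uniq (corners h).
Proof. rewrite /corners /= !inE !xpair_eqE. lia. Qed.

Lemma hex_edges_sub h e : e \in hex_edges h -> e `<=` hex_vertices h.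
Proof.
case/hex_edgesP => p ph ->; apply/fsubsetP => q.
by rewrite in_fset2 in_hex_vertices => /orP[] /eqP->; rewrite ?mem_next.
Qed.

Lemma hex_edges_neq0 h e : e \in hex_edges h -> e != fset0.
Proof.
by case/hex_edgesP => p _ ->; apply/fset0Pn; exists p; rewrite in_fset2 eqxx.
Qed.

Lemma card_hex_vertices h : #|` hex_vertices h| = 6.
Proof. by rewrite card_fseq undup_id ?uniq_corners. Qed.

(** The top and the bottom corner of a hexagon are the only two corners of the
    lattice hexagon that have the same abscissa and ordinates differing by 4;
    they determine its centre. *)
Lemma hex_vertices_inj : injective hex_vertices.
Proof.
move=> [a b] [c d] /fsetP E.
have := E (2 * a + b, 3 * b + 2); have := E (2 * a + b, 3 * b - 2).
rewrite !in_hex_vertices /corners /= !in_cons !in_nil !xpair_eqE /= !eqxx /= !orbT => bot top.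
apply/eqP; rewrite xpair_eqE.
move/esym: bot; move/esym: top.
by do ![case/orP => [/andP[/eqP ? /eqP ?]|] | case/andP=> /eqP ? /eqP ?] => //; lia.
Qed.

Definition disjoint_hexagons (P : {fset hexagon}) :=
  {in P &, forall h k p, p \in hex_vertices h -> p \in hex_vertices k -> h = k}.

Lemma mem_comp_vertices S F (v w : vertices S) :
  (val w \in comp_vertices F v) = connect (adj F) v w.
Proof.
apply/imfsetP/idP => /= [[u vu /val_inj->] //|vw].
by exists w.
Qed.

Lemma mem_comp_edges S F (v : vertices S) e :
  (e \in comp_edges F v) = (e \in F) && (e `<=` comp_vertices F v).
Proof. by rewrite !inE. Qed.

Lemma comp_vertices_eq S F (v w : vertices S) p :
  p \in comp_vertices F v -> p \in comp_vertices F w ->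
  comp_vertices F v = comp_vertices F w.
Proof.
have sym : connect_sym (@adj S F).
  by apply: sym_connect_sym => x y; rewrite /adj fsetUC.
case/imfsetP => u /= vu -> ; rewrite mem_comp_vertices => wu.
have vw : connect (adj F) v w by rewrite (connect_trans vu) // sym.
apply/fsetP => q; apply/imfsetP/imfsetP => /= -[x xv ->]; exists x => //.
  by rewrite inE (connect_trans _ xv) // sym.
by rewrite inE (connect_trans vw).
Qed.

(** Two components with a common vertex are equal, and a hexagon is determined
    by its vertices. *)
Lemma disjoint_cover_hexagons S F : disjoint_hexagons (cover_hexagons S F).
Proof.
move=> h k; rewrite !inE /=.
case/andP=> _ /existsP[v /andP[/eqP hv _]] /andP[_ /existsP[w /andP[/eqP kw _]]].
move=> p; rewrite -hv -kw => pv pw; apply: hex_vertices_inj.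
by rewrite -hv -kw; apply: comp_vertices_eq pv pw.
Qed.

(** A component is recognized as a set of vertices that no edge leaves and that
    is connected to the base point. *)
Lemma comp_verticesP S F (v : vertices S) (A : {fset lattice_point}) :
  val v \in A -> A `<=` vertices S ->
  (forall u w, [fset u; w] \in F -> u \in A -> w \in A) ->
  (forall w : vertices S, val w \in A -> connect (adj F) v w) ->
  comp_vertices F v = A.
Proof.
move=> vA AS closedA connA; apply/fsetP => p; apply/imfsetP/idP => /= [[w vw ->]|pA].
  have clA : fingraph.closed (adj F) [pred x : vertices S | val x \in A].
    move=> x y; rewrite /adj !inE => xy; apply/idP/idP; first exact: closedA.
    by apply: closedA; rewrite fsetUC.
  by have := closed_connect clA vw; rewrite !inE vA => <-.
by exists [` (fsubsetP AS _ pA)] => //; apply: connA.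
Qed.

(** The edges of the hexagons of P and the pairs {v, m v}, for v not covered by P,
    form a Clar cover whose hexagons are those of P. *)
Section MatchingComplement.
Variables (S P : {fset hexagon}) (m : lattice_point -> lattice_point).
Hypothesis PS : P `<=` S.
Hypothesis disjP : disjoint_hexagons P.
Hypothesis mP : forall v, v \in vertices S -> v \notin vertices P ->
  [/\ [fset v; m v] \in edges S, m v \notin vertices P & m (m v) = v].

Let F := edges P `|` [fset [fset v; m v] | v in vertices S `\` vertices P].

Lemma sub_vertices : vertices P `<=` vertices S.
Proof.
apply/fsubsetP => p /verticesP[h hP ph]; apply/verticesP.
by exists h => //; apply: (fsubsetP PS).
Qed.

Lemma edge_vertex v : v \in vertices S -> v \notin vertices P -> m v \in vertices S.
Proof.
move=> vS vP; have [/edgesP[h hS /hex_edges_sub /fsubsetP e] _ _] := mP vS vP.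
by apply/verticesP; exists h => //; apply: e; rewrite in_fset2 eqxx orbT.
Qed.

Lemma matched_edgeP e :
  reflect ((exists2 h, h \in P & e \in hex_edges h) \/
    exists v, [/\ v \in vertices S, v \notin vertices P & e = [fset v; m v]])
   (e \in F).
Proof.
apply: (iffP (fsetUP _ _ _)) => -[].
- by move/edgesP; left.
- by case/imfsetP => v /=; rewrite inE => /andP[vP vS] ->; right; exists v.
- by move/edgesP; left.
- case=> v [vS vP ->]; right; apply/imfsetP; exists v => //=.
  by rewrite inE vP.
Qed.

Lemma edge_in_hexagon h p e : h \in P -> p \in hex_vertices h -> e \in F ->
  p \in e -> e \in hex_edges h.
Proof.
move=> hP ph /matched_edgeP[[k kP ek] pe|[v [vS vP ->]]].
  suff -> : h = k by [].
  by apply: (disjP hP kP ph); apply: (fsubsetP (hex_edges_sub ek)).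
have pP : p \in vertices P by apply/verticesP; exists h.
have [_ mvP _] := mP vS vP.
by rewrite in_fset2 => /orP[] /eqP E; move: pP; rewrite E ?(negPf vP) ?(negPf mvP).
Qed.

Lemma comp_covered h (v : vertices S) : h \in P -> val v \in hex_vertices h ->
  comp_is_hexagon F v h.
Proof.
move=> hP vh.
have hF e : e \in hex_edges h -> e \in F by move=> eh; apply/matched_edgeP; left; exists h.
have hS : hex_vertices h `<=` vertices S.
  apply: fsubset_trans sub_vertices; apply/fsubsetP => p ph; apply/verticesP.
  by exists h.
have E : comp_vertices F v = hex_vertices h.
  apply: comp_verticesP => // [u w uw uh|w wh].
    have /hex_edges_sub/fsubsetP := edge_in_hexagon hP uh uw (fset21 _ _).
    by apply; apply: fset22.
  (* The corners, in order, form a cycle of the subgraph. *)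
  pose c : seq (vertices S) := pmap insub (corners h).
  have cE : map val c = corners h.
    rewrite pmap_filter; last exact: insubK.
    apply/all_filterP/allP => p; rewrite -in_hex_vertices => ph.
    by rewrite isSome_insub; apply: (fsubsetP hS).
  have cyc : cycle (adj F) c.
    have -> : cycle (adj F) c = cycle [rel x y | [fset x; y] \in F] (map val c).
      by rewrite cycle_map.
    rewrite cE; apply: cycle_from_next; first exact: uniq_corners.
    by move=> x xh /=; apply/hF/hex_edgesP; exists x.
  have inc (x : vertices S) : val x \in hex_vertices h -> x \in c.
    by rewrite in_hex_vertices -cE => /mapP[y yc /val_inj->].
  by apply: (connect_cycle cyc); apply: inc.
rewrite /comp_is_hexagon E eqxx /=; apply/eqP/fsetP => e; rewrite mem_comp_edges E.
apply/andP/idP => [[eF eh]|eh]; last by rewrite hF // hex_edges_sub.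
have [p pe] : exists p, p \in e.
  case/matched_edgeP: eF => [[k _ /hex_edges_neq0/fset0Pn //]|[x [_ _ ->]]].
  by exists x; apply: fset21.
exact: edge_in_hexagon hP (fsubsetP eh _ pe) eF pe.
Qed.

Lemma comp_uncovered (v : vertices S) : val v \notin vertices P ->
  comp_is_edge F v [fset val v; m (val v)].
Proof.
move=> vP; have vS := valP v; have [_ mvP mmv] := mP vS vP.
have uncov p h : p \in [fset val v; m (val v)] -> h \in P -> p \notin hex_vertices h.
  move=> pv hP; apply/negP => ph.
  have pP : p \in vertices P by apply/verticesP; exists h.
  by move: pv; rewrite in_fset2 => /orP[] /eqP E; move: vP mvP; rewrite -E pP.
have edgeE e p : e \in F -> p \in e -> p \in [fset val v; m (val v)] ->
    e = [fset val v; m (val v)].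
  move=> /matched_edgeP[[h hP eh]|[w [wS wP ->]]] pe pv.
    case/negP: (uncov _ _ pv hP).
    exact: (fsubsetP (hex_edges_sub eh)).
  have [_ _ mmw] := mP wS wP.
  move: pe pv; rewrite !in_fset2 => /orP[] /eqP-> /orP[] /eqP E.
  - by rewrite E.
  - by rewrite E mmv fsetUC.
  - by rewrite -E mmw fsetUC.
  - by rewrite -mmw E mmv.
have vF : [fset val v; m (val v)] \in F by apply/matched_edgeP; right; exists (val v).
have E : comp_vertices F v = [fset val v; m (val v)].
  apply: comp_verticesP.
  - exact: fset21.
  - apply/fsubsetP => p; rewrite in_fset2 => /orP[] /eqP-> //.
    exact: edge_vertex.
  - by move=> u w uw uv; rewrite -(edgeE _ _ uw (fset21 _ _) uv) fset22.
  - move=> w; rewrite in_fset2 => /orP[/eqP/val_inj->|/eqP E]; first exact: connect0.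
    by apply: connect1; rewrite /adj E.
rewrite /comp_is_edge E eqxx /=; apply/eqP/fsetP => e; rewrite mem_comp_edges E.
rewrite in_fset1; apply/andP/eqP => [[eF ev]|->]; last by rewrite vF.
have [p pe] : exists p, p \in e.
  case/matched_edgeP: eF => [[k _ /hex_edges_neq0/fset0Pn //]|[x [_ _ ->]]].
  by exists x; apply: fset21.
exact: edgeE eF pe (fsubsetP ev _ pe).
Qed.

Lemma matching_resonant : P \in resonant_patterns S.
Proof.
have FS : F `<=` edges S.
  apply/fsubsetP => e /matched_edgeP[[h hP eh]|[v [vS vP ->]]].
    by apply/edgesP; exists h => //; apply: (fsubsetP PS).
  by have [] := mP vS vP.
have clarF : clar_cover S F.
  rewrite /clar_cover FS /=; apply/forallP => v.
  have [/verticesP[h hP vh]|vP] := boolP (val v \in vertices P).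
    apply/orP; left; apply/existsP; exists [` (fsubsetP PS _ hP)] => /=.
    exact: comp_covered.
  have [eS _ _] := mP (valP v) vP.
  by apply/orP; right; apply/existsP; exists [` eS]; apply: comp_uncovered.
apply/imfsetP; exists F => /=; first by rewrite inE fpowersetE FS.
apply/fsetP => h; rewrite !inE /=; apply/idP/andP => [hP|[hS /existsP[v]]].
  split; first exact: (fsubsetP PS).
  have [p ph] : exists p, p \in hex_vertices h.
    by exists (2 * h.1 + h.2, 3 * h.2 + 2); rewrite in_hex_vertices mem_head.
  have pS : p \in vertices S by apply/verticesP; exists h => //; apply: (fsubsetP PS).
  by apply/existsP; exists [` pS]; apply: comp_covered.
case/andP => /eqP hv _.
have [/verticesP[k kP vk]|vP] := boolP (val v \in vertices P).
  have /andP[/eqP kv _] := comp_covered kP vk.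
  suff -> : h = k by [].
  by apply: hex_vertices_inj; rewrite -hv -kv.
have /andP[/eqP ev _] := comp_uncovered vP.
(* A hexagon has six vertices, a matched pair at most two. *)
by have := card_hex_vertices h; rewrite -hv ev cardfs2; case: eqP.
Qed.

End MatchingComplement.

(** * Matching the complement of a pattern in a pyrene chain *)

(** The row hexagons h_1 and h_2 with the hexagons above and below them; the cell
    number k (from 0) of a chain is its translate by 2 k hexagons, that is by 4 k
    in the abscissa of vertices. *)
Definition unit_cell : seq hexagon := [:: (1, 0); (2, 0); (1, 1); (2, -1)].

Definition shift_hexagon (k : int) (h : hexagon) : hexagon := (2 * k + h.1, h.2).
Definition shift_point (k : int) (p : lattice_point) : lattice_point :=
  (4 * k + p.1, p.2).

Lemma shift_point_inj k : injective (shift_point k).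
Proof. by move=> [x y] [x' y'] [] /addrI-> ->. Qed.

Lemma corners_shift k h : corners (shift_hexagon k h) = map (shift_point k) (corners h).
Proof.
case: h => a b; rewrite /corners /shift_hexagon /shift_point /=.
by do !congr (_ :: _); congr pair; ring.
Qed.

Lemma pyrene_chainP n h :
  reflect (exists k : nat, exists c, [/\ (k < n)%N, c \in unit_cell & h = shift_hexagon k%:Z c])
          (h \in pyrene_chain n).
Proof.
rewrite in_fset !mem_cat; apply: (iffP idP) => [/or3P[]|[k [c [kn + ->]]]].
- case/mapP => j; rewrite mem_index_iota => jn ->.
  case/boolP: (odd j) => oj.
    exists j./2, (1, 0); split => //; first by lia.
    by congr pair; rewrite /=; lia.
  exists j./2.-1, (2, 0); split => //; first by lia.
  by congr pair; rewrite /=; lia.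
- case/mapP => i; rewrite mem_index_iota => ji ->.
  exists i.-1, (1, 1); split => //; first by lia.
  by congr pair; rewrite /=; lia.
- case/mapP => i; rewrite mem_index_iota => ji ->.
  exists i.-1, (2, -1); split => //; first by lia.
  by congr pair; rewrite /=; lia.
rewrite !inE => /or4P[] /eqP-> {c}; apply/or3P.
- apply: Or31; apply/mapP; exists (k.*2.+1); first by rewrite mem_index_iota; lia.
  by congr pair; rewrite /=; lia.
- apply: Or31; apply/mapP; exists (k.*2.+2); first by rewrite mem_index_iota; lia.
  by congr pair; rewrite /=; lia.
- apply: Or32; apply/mapP; exists k.+1; first by rewrite mem_index_iota; lia.
  by congr pair; rewrite /=; lia.
- apply: Or33; apply/mapP; exists k.+1; first by rewrite mem_index_iota; lia.
  by congr pair; rewrite /=; lia.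
Qed.

(** The vertices of a cell, except those of its right vertical edge, which belong
    to the next cell, listed so that the matched ones are consecutive: the left
    vertical edge, then three alternate edges of the upper hexagon and three of
    the lower one.  If the left hexagon (1, 0) of the row is in the pattern (g
    true), the matched pairs include (2, 2), (3, 1), so that this hexagon is
    a union of matched pairs; otherwise they include (4, 2), (3, 1), so that this
    holds for the hexagon (2, 0). *)
Definition cell_matching (g : bool) : seq lattice_point :=
  [:: (1, 1); (1, -1)] ++
  if g then
    [:: (4, 2); (4, 4); (3, 5); (2, 4); (2, 2); (3, 1);
        (4, -2); (4, -4); (3, -5); (2, -4); (2, -2); (3, -1)]
  else
    [:: (2, 2); (2, 4); (3, 5); (4, 4); (4, 2); (3, 1);
        (2, -2); (2, -4); (3, -5); (4, -4); (4, -2); (3, -1)].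

Definition mate (g : bool) (p : lattice_point) : lattice_point :=
  let s := cell_matching g in
  let i := index p s in nth p s (if odd i then i.-1 else i.+1).

Lemma cell_matching_perm g : cell_matching g =i cell_matching false.
Proof. by apply: perm_mem; case: g. Qed.

Lemma mate_in g p : p \in cell_matching g -> mate g p \in cell_matching g.
Proof.
by move: p; apply/allP; case: g; vm_compute.
Qed.

Lemma mateK g p : p \in cell_matching g -> mate g (mate g p) = p.
Proof.
move=> pm; apply/eqP; move: p pm; apply/allP; by case: g; vm_compute.
Qed.

Definition adjacent_corners h p q :=
  [&& p \in corners h, q \in corners h & (next (corners h) p == q) || (next (corners h) q == p)].

Lemma adjacent_corners_edge h p q :
  adjacent_corners h p q -> [fset p; q] \in hex_edges h.
Proof.
case/and3P => ph qh /orP[] /eqP<-; apply/hex_edgesP; first by exists p.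
by exists q => //; rewrite fsetUC.
Qed.

Lemma adjacent_corners_shift k h p q : adjacent_corners h p q ->
  adjacent_corners (shift_hexagon k h) (shift_point k p) (shift_point k q).
Proof.
have inj := @shift_point_inj k.
rewrite /adjacent_corners corners_shift !mem_map // => /and3P[-> -> pq].
by rewrite !next_map ?uniq_corners // !inj_eq.
Qed.

Lemma mate_adjacent g p : p \in cell_matching g ->
  has (fun c => adjacent_corners c p (mate g p)) unit_cell.
Proof. by move: p; apply/allP; case: g; vm_compute. Qed.

Lemma corner_cell c p : c \in unit_cell -> p \in corners c ->
  (p \in cell_matching false) || (c == (2, 0)) && (p \in [:: (5, 1); (5, -1)]).
Proof. by move=> cu; move: p; apply/allP; move: c cu; apply/allP. Qed.

(** Upper and lower hexagons are unions of pairs for both matchings, a hexagon of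
    the row for one of them. *)
Lemma mate_corner g c p : c \in unit_cell -> p \in corners c ->
  p \in cell_matching g -> (if g then c != (2, 0) else c != (1, 0)) ->
  mate g p \in corners c.
Proof.
move=> cu pc pm gc; move: c cu p pc pm gc.
suff: all (fun c => all (fun p => [==> p \in cell_matching g, (if g then c != (2, 0) else c != (1, 0)) => mate g p \in corners c]) (corners c)) unit_cell.
  by move=> /allP + c cu => /(_ _ cu) /allP + p pc => /(_ _ pc) /implyP + pm => /(_ pm) /implyP.
by case: g; vm_compute.
Qed.

(** The abscissas of the vertices of cell k that are listed in cell_matching range
    from 4 k + 1 to 4 k + 4, so k is recovered by Euclidean division. *)
Definition partner (P : {fset hexagon}) (v : lattice_point) : lattice_point :=
  let k := ((v.1 - 1) %/ 4)%Z in
  shift_point k (mate (shift_hexagon k (1, 0) \in P) (v.1 - 4 * k, v.2)).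

Lemma partner_shift P k p : p \in cell_matching false ->
  partner P (shift_point k p) =
  shift_point k (mate (shift_hexagon k (1, 0) \in P) p).
Proof.
move=> pm; have p14 : (1 <= p.1 <= 4)%R.
  by move: p pm; apply/allP.
rewrite /partner /=.
have -> : ((4 * k + p.1 - 1) %/ 4)%Z = k by lia.
by congr (shift_point _ (mate _ _)); case: p {p14 pm} => x y; congr pair => /=; ring.
Qed.

(** The second alternative describes the last vertical edge of the chain when
    k = n. *)
Lemma vertices_pyreneP n v : v \in vertices (pyrene_chain n) ->
  exists (k : nat) p, [/\ p \in cell_matching false, v = shift_point k%:Z p &
    (k < n)%N || (0 < k <= n)%N && (p \in [:: (1, 1); (1, -1)])].
Proof.
case/verticesP => h /pyrene_chainP[k [c [kn cu ->]]].
rewrite in_hex_vertices corners_shift => /mapP[p pc ->].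
case/orP: (corner_cell cu pc) => [pm|]; first by exists k, p; split; rewrite ?kn.
rewrite !inE => /andP[_ /orP[] /eqP->].
  by exists k.+1, (1, 1); split => //; [congr pair; rewrite /=; lia | rewrite kn orbT].
by exists k.+1, (1, -1); split => //; [congr pair; rewrite /=; lia | rewrite kn orbT].
Qed.

Section Pattern.
Variables (n : nat) (P : {fset hexagon}).
Hypotheses (PS : P `<=` pyrene_chain n) (disjP : disjoint_hexagons P).

Lemma partnerK v : v \in vertices (pyrene_chain n) -> partner P (partner P v) = v.
Proof.
case/vertices_pyreneP => k [p [pm -> _]].
rewrite partner_shift // partner_shift; last first.
  by rewrite -(cell_matching_perm (shift_hexagon k%:Z (1, 0) \in P)) mate_in // cell_matching_perm.
by rewrite mateK // cell_matching_perm.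
Qed.

Lemma partner_edge v : v \in vertices (pyrene_chain n) ->
  [fset v; partner P v] \in edges (pyrene_chain n).
Proof.
case/vertices_pyreneP => k [p [pm -> kn]]; rewrite partner_shift //.
move: (_ \in P) => g.
have [{}kn|nk] := ltnP k n.
  have /hasP[c cu] : has (fun c => adjacent_corners c p (mate g p)) unit_cell.
    by apply: mate_adjacent; rewrite cell_matching_perm.
  move/(adjacent_corners_shift k%:Z)/adjacent_corners_edge => e.
  by apply/edgesP; exists (shift_hexagon k%:Z c) => //; apply/pyrene_chainP; exists k, c.
(* The rightmost vertical edge of the chain lies to the right of the last cell. *)
case: k kn nk => [|k] /=; first lia.
rewrite ltnNge => + nk; rewrite nk /= => /andP[kn p1].
have -> : shift_point k.+1%:Z p = shift_point k%:Z (5, p.2).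
  by move: p1; rewrite !inE => /orP[] /eqP->; congr pair; rewrite /=; lia.
have -> : shift_point k.+1%:Z (mate g p) = shift_point k%:Z (5, - p.2).
  by move: p1; rewrite !inE => /orP[] /eqP->; case: (g); congr pair; rewrite /=; lia.
apply/edgesP; exists (shift_hexagon k%:Z (2, 0)); first by apply/pyrene_chainP; exists k, (2, 0).
apply/adjacent_corners_edge/adjacent_corners_shift.
by move: p1; rewrite !inE => /orP[] /eqP->.
Qed.

(** If both hexagons of the row in one cell were in P, they would share a corner;
    so the matching chosen in each cell is the one for which the hexagons of P are
    unions of pairs. *)
Lemma partner_covered v : v \in vertices P -> partner P v \in vertices P.
Proof.
case/verticesP => h hP; have /pyrene_chainP[k [c [kn cu hE]]] := fsubsetP PS _ hP.
subst h; rewrite in_hex_vertices corners_shift => /mapP[p pc ->].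
apply/verticesP; exists (shift_hexagon k%:Z c) => //.
rewrite in_hex_vertices corners_shift.
have [pm|pN] := boolP (p \in cell_matching false).
  rewrite partner_shift // mem_map; last exact: shift_point_inj.
  apply: mate_corner => //; first by rewrite cell_matching_perm.
  have [gP|] := boolP (shift_hexagon k%:Z (1, 0) \in P); last first.
    by apply: contra => /eqP <-.
  apply/eqP => c2; subst c.
  suff : shift_hexagon k%:Z (1, 0) = shift_hexagon k%:Z (2, 0) by case; lia.
  apply: (disjP gP hP (p := shift_point k%:Z (3, 1)));
    by rewrite in_hex_vertices corners_shift mem_map //; apply: shift_point_inj.
(* The remaining corners are on the right vertical edge, matched in the next cell. *)
have := corner_cell cu pc; rewrite (negPf pN) => /andP[/eqP c2 p5].
rewrite !inE in p5.
have -> : partner P (shift_point k%:Z p) = shift_point k%:Z (5, - p.2).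
  have -> : shift_point k%:Z p = shift_point k.+1%:Z (1, p.2).
    by case/orP: p5 => /eqP->; congr pair; rewrite /=; lia.
  rewrite partner_shift; last by case/orP: p5 => /eqP->.
  have -> g : mate g (1, p.2) = (1, - p.2).
    by case/orP: p5 => /eqP->; case: g.
  by congr pair; rewrite /=; lia.
rewrite mem_map; last exact: shift_point_inj.
by rewrite c2; case/orP: p5 => /eqP->.
Qed.

Lemma pyrene_resonant : P \in resonant_patterns (pyrene_chain n).
Proof.
apply: (@matching_resonant _ _ (partner P)) => // v vS vP.
split; [exact: partner_edge| |exact: partnerK].
by apply: contra vP => /partner_covered; rewrite partnerK.
Qed.

End Pattern.

Lemma resonant_pyreneE n P : P \in resonant_patterns (pyrene_chain n) <->
  P `<=` pyrene_chain n /\ disjoint_hexagons P.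
Proof.
split=> [/imfsetP[F /= _ ->]|[]]; last exact: pyrene_resonant.
split; last exact: disjoint_cover_hexagons.
by apply/fsubsetP => h; rewrite !inE => /andP[].
Qed.

(** * Independence polynomials *)

Section IndependencePolynomial.
Variables (T : choiceType) (r : rel T).

Definition independent (P : {fset T}) : bool :=
  all2rel (fun x y => (x == y) || ~~ r x y) P.

Lemma independentP (P : {fset T}) :
  reflect {in P &, forall x y, x != y -> ~~ r x y} (independent P).
Proof.
apply: (iffP allrelP) => H x y xP yP; first by have := H x y xP yP; case: eqP.
by case: eqVneq => //= xy; apply: H.
Qed.

Definition independence_poly (S : {fset T}) : {poly int} :=
  \sum_(P <- fpowerset S | independent P) 'X^#|` P|.

Lemma independence_poly0 : independence_poly fset0 = 1.
Proof.
rewrite /independence_poly fpowerset0 big_mkcond big_seq_fset1.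
have -> : independent fset0 by apply/independentP.
by rewrite cardfs0.
Qed.

Hypothesis r_sym : symmetric r.

(** Independent sets that avoid h are counted by the first term; those that
    contain h are h |` Q with Q independent and away from the neighbours of h. *)
Lemma independence_polyU1 (h : T) (S : {fset T}) : h \notin S ->
  independence_poly (h |` S) =
  independence_poly S + 'X * independence_poly [fset k in S | ~~ r h k].
Proof.
move=> hS; rewrite /independence_poly (bigID (fun P : {fset T} => h \in P)) /= addrC.
have hN (Q : {fset T}) : Q `<=` S -> h \notin Q.
  by move=> QS; apply: contra hS; apply: (fsubsetP QS).
congr (_ + _).
  rewrite [LHS]big_fset_condE [RHS]big_fset_condE; congr (\sum_(P <- enum_fset _) _).
  apply/fsetP => P; rewrite !inE /= !fpowersetE.
  have [iP|] := boolP (independent P); rewrite ?andbF // !andbT.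
  apply/andP/idP => [[/fsubsetP PS hP]|PS].
    apply/fsubsetP => x xP; have := PS _ xP; rewrite in_fset1U => /orP[/eqP xh|//].
    by rewrite -xh xP in hP.
  by split; [apply: fsubset_trans PS (fsubsetU1 _ _) | apply: hN].
rewrite mulr_sumr [LHS]big_fset_condE [RHS]big_fset_condE.
set D := [fset Q in fpowerset [fset k in S | _] | _].
have subD Q : Q \in D -> [/\ Q `<=` S, independent Q & {in Q, forall k, ~~ r h k}].
  rewrite !inE /= fpowersetE => /andP[/fsubsetP QS iQ]; split => //.
    by apply/fsubsetP => x /QS; rewrite !inE => /andP[].
  by move=> x /QS; rewrite !inE => /andP[].
transitivity (\sum_(P <- [fset (h |` Q) | Q in D]) 'X^#|` P| : {poly int}).
  congr (\sum_(P <- enum_fset _) _); apply/fsetP => P; rewrite !inE /= fpowersetE.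
  apply/and3P/imfsetP => [[/fsubsetP PS /independentP iP hP]|[Q /= /subD[QS /independentP iQ rQ] ->]].
    exists (P `\ h); last by rewrite fsetD1K.
    rewrite !inE /= fpowersetE; apply/andP; split.
      apply/fsubsetP => x; rewrite !inE => /andP[xh xP].
      rewrite iP // 1?eq_sym // andbT.
      by have := PS _ xP; rewrite in_fset1U (negPf xh).
    by apply/independentP => x y; rewrite !inE => /andP[_ xP] /andP[_ yP]; apply: iP.
  split; [exact: fsetUS| |exact: fset1U1].
  apply/independentP => x y; rewrite !in_fset1U => /orP[/eqP->|xQ] /orP[/eqP->|yQ].
  - by rewrite eqxx.
  - by move=> _; apply: rQ.
  - by move=> _; rewrite r_sym; apply: rQ.
  - exact: iQ.
rewrite big_imfset /=; last first.
  move=> Q1 Q2 /subD[/hN h1 _ _] /subD[/hN h2 _ _] /fsetP E; apply/fsetP => x.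
  have := E x; rewrite !in_fset1U; case: eqVneq => //= -> _.
  by rewrite (negPf h1) (negPf h2).
by apply: eq_big_seq => Q /subD[/hN hQ _ _]; rewrite cardfsU1 hQ add1n exprS.
Qed.

Lemma independence_polyU1_isolated (h : T) (S : {fset T}) :
  {in S, forall k, ~~ r h k} -> h \notin S ->
  independence_poly (h |` S) = (1 + 'X) * independence_poly S.
Proof.
move=> iso hS; rewrite independence_polyU1 // mulrDl mul1r; congr (_ + _ * independence_poly _).
by apply/fsetP => k; rewrite !inE /=; case kS: (k \in S); rewrite // iso.
Qed.

End IndependencePolynomial.

(** * The recurrence for pyrene chains *)

Definition touch (h k : hexagon) : bool :=
  has (mem (corners k)) (corners h).

Lemma touch_sym : symmetric touch.
Proof. by move=> h k; rewrite /touch has_sym. Qed.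

Lemma independent_touchP P : reflect (disjoint_hexagons P) (independent touch P).
Proof.
apply: (iffP (independentP _ _)) => H h k hP kP.
  move=> p; rewrite !in_hex_vertices => ph pk; apply/eqP/negPn/negP => hk.
  by have /hasPn/(_ _ ph) := H h k hP kP hk; rewrite /= pk.
apply: contraNN => /hasP[p ph pk]; apply/eqP.
by apply: (H h k hP kP p); rewrite in_hex_vertices.
Qed.

Lemma sextet_sum (S : {fset hexagon}) :
  sextet_poly S = \sum_(P <- resonant_patterns S) 'X^#|` P|.
Proof.
rewrite /sextet_poly; transitivity (\sum_(k < (clar_number S).+1)
   \sum_(P <- resonant_patterns S | #|` P| == k) 'X^k : {poly int}).
  apply: eq_bigr => k _; rewrite big_fset_condE big_const_seq count_predT /=.
  by rewrite iter_addr addr0 scaler_nat.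
rewrite (exchange_big_dep xpredT) //= big_seq [RHS]big_seq.
apply: eq_bigr => P Pres.
have PC : (#|` P| < (clar_number S).+1)%N.
  by rewrite ltnS /clar_number; apply: (@leq_bigmax_seq _ _ xpredT (fun P : {fset hexagon} => #|` P|) P Pres).
rewrite (big_pred1 (Ordinal PC)) // => k; rewrite -val_eqE /= eq_sym.
Qed.

Lemma sextet_pyreneE n :
  sextet_poly (pyrene_chain n) = independence_poly touch (pyrene_chain n).
Proof.
rewrite sextet_sum /independence_poly [RHS]big_fset_condE; congr (\sum_(P <- enum_fset _) _).
apply/fsetP => P; apply/idP/idP => [/resonant_pyreneE[PS dP]|iP].
  by rewrite !inE /= fpowersetE PS; apply/independent_touchP.
apply/resonant_pyreneE; move: iP; rewrite !inE /= fpowersetE.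
by case/andP => PS /independent_touchP.
Qed.

Lemma touch_shift j c c' : touch (shift_hexagon j c) (shift_hexagon j c') = touch c c'.
Proof.
rewrite /touch !corners_shift has_map; apply: eq_has => p.
exact: (mem_map (@shift_point_inj j)).
Qed.

Lemma shift_hexagon_inj j : injective (shift_hexagon j).
Proof. by move=> [x y] [x' y'] [] /addrI-> ->. Qed.

Lemma touch_in_cell :
  ((touch (1, 0) (2, 0) = true) * (touch (1, 0) (1, 1) = true) *
   (touch (1, 0) (2, -1) = true) * (touch (2, 0) (1, 1) = true) *
   (touch (2, 0) (2, -1) = true) * (touch (1, 1) (2, -1) = false))%type.
Proof. by do !split; vm_compute. Qed.

Lemma corner_abscissa c p : c \in unit_cell -> p \in corners c ->
  [&& 1 <= p.1 <= 5, (p.1 == 1) ==> (c == (1, 0)) & (p.1 == 5) ==> (c == (2, 0))].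
Proof. by move=> cu; move: p; apply/allP; move: c cu; apply/allP; vm_compute. Qed.

(** The only hexagons of distinct cells that touch are the left hexagon of the row
    in one cell and the right one, here written as shift_hexagon k (0, 0), in the
    previous cell: a common vertex has abscissa 1 in the former and 5 in the
    latter. *)
Lemma touch_cells (j k : nat) c c' : (j < k)%N -> c \in unit_cell -> c' \in unit_cell ->
  touch (shift_hexagon k%:Z c) (shift_hexagon j%:Z c') =
  (c == (1, 0)) && (shift_hexagon j%:Z c' == shift_hexagon k%:Z (0, 0)).
Proof.
move=> jk cu cu'; apply/idP/andP => [|[/eqP-> /eqP->]]; last by rewrite touch_shift; vm_compute.
rewrite /touch !corners_shift => /hasP[_ /mapP[[x y] pc ->] /mapP[[x' y'] qc [E1 E2]]].
case/and3P: (corner_abscissa cu pc) => /= x15 x1 _.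
case/and3P: (corner_abscissa cu' qc) => /= x15' _ x5.
rewrite /= in E1.
have kj : k = j.+1 by lia.
have qE : x' = 5 by lia.
have pE : x = 1 by lia.
rewrite qE in x5; rewrite pE in x1; split=> //.
by rewrite (eqP x5) kj; apply/eqP; congr pair; rewrite /=; lia.
Qed.

Lemma pyrene_chain0 : pyrene_chain 0 = fset0.
Proof. by apply/fsetP => h; rewrite in_fset0; apply/negP => /pyrene_chainP[k [c []]]. Qed.

Lemma pyrene_chainS n (u := shift_hexagon n%:Z) :
  pyrene_chain n.+1 = u (1, 0) |` (u (2, 0) |` (u (1, 1) |` (u (2, -1) |` pyrene_chain n))).
Proof.
apply/fsetP => h; rewrite !in_fset1U; apply/pyrene_chainP/idP.
  case=> k [c [kn cu ->]]; have [kn'|kn'] := ltnP k n.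
    by do 4!(apply/orP; right); apply/pyrene_chainP; exists k, c.
  have -> : k = n by lia.
  by move: cu; rewrite !inE /u => /or4P[] /eqP->; rewrite eqxx ?orbT.
case/or4P => [/eqP->|/eqP->|/eqP->|/orP[/eqP->|/pyrene_chainP[k [c [kn cu ->]]]]].
- by exists n, (1, 0).
- by exists n, (2, 0).
- by exists n, (1, 1).
- by exists n, (2, -1).
by exists k, c; split => //; lia.
Qed.

Lemma filter_fsetU1 (T : choiceType) (p : pred T) (h : T) (S : {fset T}) :
  [fset k in h |` S | p k] =
  if p h then h |` [fset k in S | p k] else [fset k in S | p k].
Proof.
by apply/fsetP => k; case: ifP => ph; rewrite !inE /=; case: eqVneq => //= ->; rewrite ph ?andbF.
Qed.

Lemma eq_in_filter_fset (T : choiceType) (p q : pred T) (S : {fset T}) :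
  {in S, p =1 q} -> [fset k in S | p k] = [fset k in S | q k].
Proof.
by move=> pq; apply/fsetP => k; rewrite !inE /=; apply: andb_id2l; apply: pq.
Qed.

Lemma filter_fset_id (T : choiceType) (S : {fset T}) : [fset k in S | true] = S.
Proof. by apply/fsetP => k; rewrite !inE /= andbT. Qed.

Lemma filter_fset_neq (T : choiceType) (S : {fset T}) h : [fset k in S | k != h] = S `\ h.
Proof. by apply/fsetP => k; rewrite !inE /= andbC. Qed.

(** The chain without the last hexagon of its row.  For m = 0 the hexagon taken out
    is not in the chain, which makes the recurrence valid from the start. *)
Definition truncated_chain (m : nat) := pyrene_chain m `\ shift_hexagon m%:Z (0, 0).

Section Recurrence.
Variable n : nat.
Let u := shift_hexagon n%:Z.

Lemma touch_chain c h : c \in unit_cell -> h \in pyrene_chain n ->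
  touch (u c) h = (c == (1, 0)) && (h == u (0, 0)).
Proof. by move=> cu /pyrene_chainP[j [c' [jn cu' ->]]]; apply: touch_cells. Qed.

Lemma notin_chain c : c \in unit_cell -> u c \notin pyrene_chain n.
Proof.
move=> cu; apply/negP => cn; have := touch_chain cu cn.
rewrite touch_shift; have -> : touch c c by move: c cu {cn}; apply/allP; vm_compute.
by move/esym/andP => [/eqP-> /eqP/shift_hexagon_inj].
Qed.

Let I := independence_poly touch.

Lemma chain_poly_sides : I (u (1, 1) |` (u (2, -1) |` pyrene_chain n)) = (1 + 'X) ^+ 2 * I (pyrene_chain n).
Proof.
rewrite /I !independence_polyU1_isolated ?mulrA ?expr2 //; try exact: touch_sym.
- by move=> h hn; rewrite touch_chain.
- exact: notin_chain.
- move=> h; rewrite in_fset1U => /orP[/eqP->|hn]; last by rewrite touch_chain.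
  by rewrite touch_shift; vm_compute.
- by rewrite in_fset1U negb_or notin_chain // andbT; apply/eqP => /shift_hexagon_inj.
Qed.

Lemma filter_chain c : c \in unit_cell ->
  [fset k in pyrene_chain n | ~~ touch (u c) k] =
  if c == (1, 0) then truncated_chain n else pyrene_chain n.
Proof.
move=> cu; case: ifP => c1.
  rewrite /truncated_chain -filter_fset_neq; apply: eq_in_filter_fset => h hn.
  by rewrite touch_chain // c1.
rewrite -[RHS]filter_fset_id; apply: eq_in_filter_fset => h hn.
by rewrite touch_chain // c1.
Qed.

Lemma chain_poly_right :
  I (u (2, 0) |` (u (1, 1) |` (u (2, -1) |` pyrene_chain n))) =
  ((1 + 'X) ^+ 2 + 'X) * I (pyrene_chain n).
Proof.
rewrite /I independence_polyU1; first last.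
- by rewrite !in_fset1U !(inj_eq (@shift_hexagon_inj _)) /= notin_chain.
- exact: touch_sym.
rewrite -/I chain_poly_sides !filter_fsetU1 !touch_shift !touch_in_cell /= filter_chain //.
by rewrite /= mulrDl.
Qed.

(** Deletion of the left hexagon of the row in the last cell; its neighbours are
    all other hexagons of the cell and the last hexagon of the row of the
    previous chain. *)
Lemma chain_poly_step :
  I (pyrene_chain n.+1) =
  (1 + 3%:R * 'X + 'X ^+ 2) * I (pyrene_chain n) + 'X * I (truncated_chain n).
Proof.
rewrite pyrene_chainS -/u /I independence_polyU1; first last.
- by rewrite !in_fset1U !(inj_eq (@shift_hexagon_inj _)) /= notin_chain.
- exact: touch_sym.
rewrite -/I chain_poly_right !filter_fsetU1 !touch_shift !touch_in_cell /= filter_chain //.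
rewrite /=; congr (_ * _ + _); ring.
Qed.

(** The last hexagon of the row touches exactly the other hexagons of its cell, so
    deleting it together with its neighbours leaves the previous chain. *)
Lemma truncated_poly_step :
  I (truncated_chain n.+1) = I (pyrene_chain n.+1) - 'X * I (pyrene_chain n).
Proof.
have notin : u (2, 0) \notin u (1, 0) |` (u (1, 1) |` (u (2, -1) |` pyrene_chain n)).
  by rewrite !in_fset1U !(inj_eq (@shift_hexagon_inj _)) /= notin_chain.
have -> : truncated_chain n.+1 = pyrene_chain n.+1 `\ u (2, 0).
  by rewrite /truncated_chain; congr (_ `\ _); congr pair; rewrite /=; lia.
rewrite pyrene_chainS fsetUCA fsetU1K // [in RHS]/I independence_polyU1 //; last exact: touch_sym.
rewrite -/I !filter_fsetU1 !touch_shift (touch_sym (2, 0) (1, 0)) !touch_in_cell /= filter_chain //.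
by rewrite /= addrK.
Qed.

End Recurrence.

Lemma sextet_pyrene0 : sextet_poly (pyrene_chain 0) = 1.
Proof. by rewrite sextet_pyreneE pyrene_chain0 independence_poly0. Qed.

Lemma sextet_pyrene1 : sextet_poly (pyrene_chain 1) = 'X ^+ 2 + 4%:R * 'X + 1.
Proof.
rewrite sextet_pyreneE chain_poly_step /truncated_chain pyrene_chain0 fset0D independence_poly0.
ring.
Qed.

Lemma sextet_pyreneSS n : sextet_poly (pyrene_chain n.+2) =
  ('X ^+ 2 + 4%:R * 'X + 1) * sextet_poly (pyrene_chain n.+1) -
  'X ^+ 2 * sextet_poly (pyrene_chain n).
Proof. by rewrite !sextet_pyreneE chain_poly_step truncated_poly_step; ring. Qed.

End Combinatorics.

(** * Zeros *)

Section Zeros.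
Variable R : realType.
Implicit Types (t y : R) (n : nat).

Definition real_pyrene_poly n : {poly R} :=
  map_poly intr (sextet_poly (pyrene_chain n)).

Lemma horner_pyrene0 y : (real_pyrene_poly 0).[y] = 1.
Proof. by rewrite /real_pyrene_poly sextet_pyrene0 rmorph1 hornerC. Qed.

Lemma map_pyrene_factor y :
  (map_poly intr ('X ^+ 2 + 4%:R * 'X + 1 : {poly int})).[y] = y ^+ 2 + 4 * y + 1.
Proof.
rewrite !rmorphD /= map_polyXn rmorphM /= map_polyX rmorph_nat rmorph1.
by rewrite !hornerE /=; ring.
Qed.

Lemma horner_pyrene1 y : (real_pyrene_poly 1).[y] = y ^+ 2 + 4 * y + 1.
Proof. by rewrite /real_pyrene_poly sextet_pyrene1 map_pyrene_factor. Qed.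

Lemma horner_pyreneSS n y : (real_pyrene_poly n.+2).[y] =
  (y ^+ 2 + 4 * y + 1) * (real_pyrene_poly n.+1).[y] - y ^+ 2 * (real_pyrene_poly n).[y].
Proof.
rewrite /real_pyrene_poly sextet_pyreneSS.
move: (sextet_poly _) (sextet_poly _) => p1 p0.
rewrite rmorphB rmorphM [X in _ - X]rmorphM /= map_polyXn.
by rewrite hornerD hornerN hornerM map_pyrene_factor hornerM hornerXn.
Qed.

(** Since sin ((n + 2) t) = 2 cos t sin ((n + 1) t) - sin (n t), both sides satisfy
    the same recurrence: p n / y ^ n is the Chebyshev polynomial U_n at cos t. *)
Lemma chebyshev_rec (p : nat -> R) y t :
  p 0%N = 1 -> p 1%N = 2 * cos t * y ->
  (forall n, p n.+2 = 2 * cos t * y * p n.+1 - y ^+ 2 * p n) ->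
  forall n, p n * sin t = y ^+ n * sin (n.+1%:R * t).
Proof.
move=> p0 p1 pSS.
have sin_rec k : sin (k.+2%:R * t) = 2 * cos t * sin (k.+1%:R * t) - sin (k%:R * t).
  have -> : k.+2%:R * t = k.+1%:R * t + t by rewrite -[k.+2%:R]natr1; ring.
  have -> : k%:R * t = k.+1%:R * t - t by rewrite -[k.+1%:R]natr1; ring.
  by rewrite sinB sinD; ring.
elim/ltn_ind => -[|[|n]] IH.
- by rewrite p0 expr0 !mul1r.
- by rewrite p1 sin_rec mul0r sin0 subr0 mul1r expr1; ring.
have := IH n.+1 (ltnSn _); have := IH n (ltnW (ltnSn _)).
rewrite pSS (sin_rec n.+1) !exprS.
move: (sin (n.+1%:R * t)) (sin (n.+2%:R * t)) => s0 s1 E0 E1.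
transitivity (2 * cos t * y * (p n.+1 * sin t) - y ^+ 2 * (p n * sin t)); first ring.
by rewrite E1 E0 !exprS; ring.
Qed.

Lemma pyrene_poly_trig n y t : y ^+ 2 + 1 = (4 + 2 * cos t) * y ->
  (real_pyrene_poly n).[- y] * sin t = y ^+ n * sin (n.+1%:R * t).
Proof.
move=> yt.
have coef : (- y) ^+ 2 + 4 * - y + 1 = 2 * cos t * y.
  by rewrite sqrrN addrAC yt; ring.
apply: (chebyshev_rec (p := fun n => (real_pyrene_poly n).[- y])).
- exact: horner_pyrene0.
- by rewrite horner_pyrene1 coef.
- by move=> m; rewrite -coef -(sqrrN y); exact: horner_pyreneSS.
Qed.

(** Positive elements of R[i] are real, so the distances are compared in R. *)
Lemma cvg_real_complex (z : nat -> R) (l : R) :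
  (z n @[n --> \oo] --> l)%classic ->
  (((z n)%:C%C : R[i]^o) @[n --> \oo] --> (l%:C%C : R[i]^o))%classic.
Proof.
move=> zl; apply/cvgrPdist_lt => e e0.
have [eR e0'] : e = (complex.Re e)%:C%C /\ 0 < complex.Re e.
  by move: e0; rewrite ltcE /= => /andP[/eqP i0 ->]; split=> //; case: e i0 => a b /= ->.
move/cvgrPdist_lt: zl => /(_ _ e0'); apply: filterS => n.
have -> : (l%:C - (z n)%:C = (l - z n)%:C :> R[i])%C by rewrite rmorphB.
rewrite normc_def /= expr0n addr0 sqrtr_sqr.
by rewrite {2}eR ltcR.
Qed.

(** For s = 1 and s = -1, the two roots of y ^ 2 - 2 c y + 1 with c = 2 + cos t. *)
Definition branch (s t : R) : R := 2 + cos t + s * Num.sqrt ((2 + cos t) ^+ 2 - 1).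

Lemma sqrt_arg_ge0 t : 0 <= (2 + cos t) ^+ 2 - 1.
Proof. have := cos_geN1 t; nra. Qed.

Lemma branchE (s t : R) : s ^+ 2 = 1 ->
  branch s t ^+ 2 + 1 = (4 + 2 * cos t) * branch s t.
Proof.
move=> s2; have := sqr_sqrtr (sqrt_arg_ge0 t); rewrite /branch.
set q := Num.sqrt _ => q2.
have -> : (2 + cos t + s * q) ^+ 2 = (2 + cos t) ^+ 2 + 2 * (2 + cos t) * s * q + s ^+ 2 * q ^+ 2 by ring.
by rewrite s2 q2; ring.
Qed.

Lemma cvg_branch s (u : nat -> R) t : (u n @[n --> \oo] --> t)%classic ->
  (branch s (u n) @[n --> \oo] --> branch s t)%classic.
Proof.
move=> ut.
have cu : (2 + cos (u n) @[n --> \oo] --> 2 + cos t)%classic.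
  apply: cvgD; first exact: cvg_cst.
  by apply: continuous_cvg => //; apply: continuous_cos.
apply: cvgD => //; apply: cvgM; first exact: cvg_cst.
apply: (@cvg_comp _ _ _ (fun n => (2 + cos (u n)) ^+ 2 - 1) Num.sqrt _ _ _ _ (@sqrt_continuous R _)).
apply: cvgB; last exact: cvg_cst.
by rewrite expr2; under eq_fun do rewrite expr2; apply: cvgM.
Qed.

(** The product of the two roots is 1 and their sum 2 c is at most 6, whence
    (y - 3) ^ 2 <= 8. *)
Lemma branch_itv s t : s ^+ 2 = 1 ->
  - (Num.sqrt 2 + 1) ^+ 2 <= - branch s t <= - (Num.sqrt 2 - 1) ^+ 2.
Proof.
move=> s2; have := branchE t s2; have c1 := cos_le1 t; have c2 := cos_geN1 t.
have r2 : Num.sqrt 2 ^+ 2 = 2 :> R by rewrite sqr_sqrtr.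
have r0 : 0 <= Num.sqrt 2 :> R by apply: sqrtr_ge0.
move: (branch s t) (Num.sqrt 2) r2 r0 => y r r2 r0 yE.
have y0 : 0 < y by nra.
have y6 : (y - 3) ^+ 2 <= (2 * r) ^+ 2 by nra.
have l1 : - (2 * r) <= y - 3 by nra.
have l2 : y - 3 <= 2 * r by nra.
by apply/andP; split; nra.
Qed.

(** Conversely c = (y + 1 / y) / 2 lies in [1, 3], and c ^ 2 - 1 is the square of
    y - c, whose sign selects the branch. *)
Lemma branch_surj y : - (Num.sqrt 2 + 1) ^+ 2 <= - y <= - (Num.sqrt 2 - 1) ^+ 2 ->
  exists s t, [/\ s ^+ 2 = 1, 0 <= t <= pi & branch s t = y].
Proof.
have r2 : Num.sqrt 2 ^+ 2 = 2 :> R by rewrite sqr_sqrtr.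
have r0 : 0 <= Num.sqrt 2 :> R by apply: sqrtr_ge0.
move: (Num.sqrt 2) r2 r0 => r r2 r0 /andP[y1 y2].
have y0 : 0 < y by nra.
pose c : R := (y ^+ 2 + 1) / (2 * y).
have cE : 2 * c * y = y ^+ 2 + 1 by rewrite /c; field; rewrite gt_eqF.
clearbody c.
have c1 : 0 <= c - 1.
  rewrite -(pmulr_rge0 _ y0); have := sqr_ge0 (y - 1); lra.
have c3 : 0 <= 3 - c.
  rewrite -(pmulr_rge0 _ y0).
  (* The segment has end points 3 - 2 r and 3 + 2 r, of product 1. *)
  have l1 : 0 <= y - (3 - 2 * r) by lra.
  have l2 : 0 <= 3 + 2 * r - y by lra.
  have := mulr_ge0 l1 l2; nra.
have c2 : -1 <= c - 2 <= 1 by lra.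
exists ((-1) ^+ (y - c < 0)%R), (acos (c - 2)).
have [-> cosE] := acos_def c2.
split=> //; first by rewrite -exprM mulnC exprM sqrrN !expr1n.
rewrite /branch cosE [2 + _]addrC subrK.
have -> : c ^+ 2 - 1 = (y - c) ^+ 2 by nra.
by rewrite sqrtr_sqr -realEsign ?num_real //; ring.
Qed.

(** A multiple k pi / (n + 1) close to t; the factor n - 1 ensures that
    1 <= k <= n when 0 <= t <= pi and n is positive. *)
Definition node t n : R := (Num.trunc (n.-1%:R * (t / pi))).+1%:R / n.+1%:R * pi.

Lemma node_root t n : 0 <= t <= pi -> (0 < n)%N ->
  sin (node t n) != 0 /\ sin (n.+1%:R * node t n) = 0.
Proof.
move=> /andP[t0 tpi] n0; rewrite /node; set k := Num.trunc _.
have pi0 : 0 < pi :> R by apply: pi_gt0.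
have kn : (k.+1 <= n)%N.
  rewrite -(prednK n0) ltnS -(ler_nat R).
  apply: (@le_trans _ _ (n.-1%:R * (t / pi))).
    by rewrite truncn_le mulr_ge0 ?divr_ge0 // ltW.
  by rewrite -[leRHS]mulr1 ler_wpM2l // ler_pdivrMr // mul1r.
split.
  rewrite gt_eqF // sin_gt0_pi // mulr_gt0 ?divr_gt0 //=.
  by rewrite -[ltRHS]mul1r ltr_pM2r // ltr_pdivrMr // mul1r ltr_nat.
rewrite mulrA mulrCA divff ?mulr1 //.
elim: (k.+1) => [|m IH]; first by rewrite mul0r sin0.
by rewrite -natr1 mulrDl mul1r sinDpi IH oppr0.
Qed.

(** With u = t / pi, the integer k and (n + 1) u differ by at most 2, because
    (n - 1) u < k <= (n - 1) u + 1. *)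
Lemma cvg_node t : 0 <= t <= pi -> (node t n @[n --> \oo] --> t)%classic.
Proof.
move=> /andP[t0 tpi]; have pi0 : 0 < pi :> R by apply: pi_gt0.
have h : (2 * (pi : R) * harmonic n @[n --> \oo] --> 2 * (pi : R) * 0)%classic.
  by apply: cvgM; [apply: cvg_cst | apply: cvg_harmonic].
have hl : (t - 2 * pi * harmonic n @[n --> \oo] --> t - 2 * pi * 0)%classic.
  by apply: cvgB => //; apply: cvg_cst.
have hr : (t + 2 * pi * harmonic n @[n --> \oo] --> t + 2 * pi * 0)%classic.
  by apply: cvgD => //; apply: cvg_cst.
rewrite mulr0 subr0 in hl; rewrite mulr0 addr0 in hr.
apply: squeeze_cvgr hl hr; near=> n.
have n0 : (0 < n)%N by near: n; exists 1%N.
have n1 : n.-1%:R + 1 = n%:R :> R by rewrite natr1 prednK.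
have u0 : 0 <= t / pi by rewrite divr_ge0 // ltW.
have u1 : t / pi <= 1 by rewrite ler_pdivrMr // mul1r.
have := truncn_itv (mulr_ge0 (ler0n R n.-1) u0).
rewrite /node /=; set k := Num.trunc _; rewrite -natr1 => /andP[k1 k2].
have tE : t = t / pi * n.+1%:R * (pi * n.+1%:R^-1) 
  by rewrite mulrACA divfK ?gt_eqF // mulfV ?pnatr_eq0 // mulr1.
move: (t / pi) u0 u1 k1 k2 tE => u u0 u1 k1 k2 ->.
have p0 : 0 < pi * n.+1%:R^-1 :> R by rewrite mulr_gt0 // invr_gt0.
have -> : (k%:R + 1) / n.+1%:R * pi = (k%:R + 1) * (pi * n.+1%:R^-1) :> R by ring.
rewrite -[2 * pi * _]mulrA -mulrBl -mulrDl !ler_pM2r // -natr1 -n1.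
by apply/andP; split; nra.
Unshelve. all: by end_near. Qed.

Lemma real_zeros x : - (Num.sqrt 2 + 1) ^+ 2 <= x <= - (Num.sqrt 2 - 1) ^+ 2 ->
  exists z : nat -> R, [/\ forall n, (1 <= n)%N -> root (real_pyrene_poly n) (z n),
    forall n, - (Num.sqrt 2 + 1) ^+ 2 <= z n <= - (Num.sqrt 2 - 1) ^+ 2 &
    (z n @[n --> \oo] --> x)%classic].
Proof.
rewrite -[x]opprK => /branch_surj[s [t [s2 t_itv <-]]].
exists (fun n => - branch s (node t n)); split => [n n0|n|].
- have [s0 sn0] := node_root t_itv n0.
  have := pyrene_poly_trig n (branchE (node t n) s2).
  rewrite sn0 mulr0 => /eqP; rewrite mulf_eq0 (negPf s0) orbF.
  by rewrite /root.
- exact: branch_itv.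
- by apply: cvgN; apply: cvg_branch; apply: cvg_node.
Qed.

Lemma root_real_complex n (x : R) :
  root (real_pyrene_poly n) x -> root (pyrene_poly R n) x%:C%C.
Proof.
rewrite -(fmorph_root (real_complex R)) /real_pyrene_poly -map_poly_comp.
by congr (root _ _); apply: eq_map_poly => k /=; rewrite rmorph_int.
Qed.

End Zeros.

Theorem mainTheorem3 (R : realType) :
  let a : R := - (Num.sqrt 2 + 1) ^+ 2 in
  let b : R := - (Num.sqrt 2 - 1) ^+ 2 in
  (forall x : R[i]^o, real_segment a b x -> limit_of_zeros (pyrene_poly R) x)
  /\ dense_in (zero_set (pyrene_poly R)) (real_segment a b).
Proof.
move=> a b.
have zeros (x : R[i]^o) : real_segment a b x ->
    exists z : nat -> R, [/\ forall n, (1 <= n)%N -> root (pyrene_poly R n) (z n)%:C%C,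
      forall n, (a <= z n <= b)%R & ((z n)%:C%C : R[i]^o) @[n --> \oo] --> x]%classic.
  case=> r /=; rewrite in_itv /= => /real_zeros[z [zroot zitv zr]] <-.
  exists z; split => [n n0|n|]; last exact: cvg_real_complex.
    by apply: root_real_complex; apply: zroot.
  exact: zitv.
split=> x /zeros[z [zroot zitv zx]]; first by exists (fun n => (z n)%:C%C).
move=> B /zx zB.
have [N _ BN] := zB; pose n := N.+1.
have n0 : (1 <= n)%N by [].
have Bn : B (z n)%:C%C by apply: BN => /=; apply: leqnSn.
exists (z n)%:C%C; split => //; split; first by exists n => //; apply: zroot.
by exists (z n) => //=; rewrite in_itv /=; apply: zitv.
Qed.
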